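(* Let $\Omega$ be a finite set, $\mu$ a probability measure on $\Omega$ with $\mu(\sigma)>0$ for all $\sigma\in\Omega$, and $f_1,\dots,f_m\subseteq\Omega$ (flaws). Suppose that for each $i\in[m]$ and each $\sigma\in f_i$ there is a probability distribution $\rho_i(\sigma,\cdot)$ on $\Omega$. Say that $f_i$ causes $f_j$ if there exist $\sigma\in f_i$ and $\tau\in\Omega$ with $\rho_i(\sigma,\tau)>0$, $\tau\in f_j$, and either $i=j$ or $\sigma\notin f_j$. Let $C$ be any digraph on $[m]$ containing the edge $i\to j$ whenever $f_i$ causes $f_j$, and let $\Gamma(i)$ be the set of out-neighbors of $i$ in $C$. Define the charge $$\gamma_i=\max_{\tau\in\Omega}\sum_{\sigma\in f_i}\frac{\mu(\sigma)}{\mu(\tau)}\rho_i(\sigma,\tau).$$ Then for every $i\in[m]$ and every $S\subseteq[m]\setminus\Gamma(i)$ such that $\mu\bigl(\bigcap_{j\in S}\overline{f_j}\bigr)>0$, $$\mu\Bigl(f_i\;\Big|\;\bigcap_{j\in S}\overline{f_j}\Bigr)\le\gamma_i,$$ where $\overline{f_j}=\Omega\setminus f_j$.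
   Context: This describes a local search algorithm on state space $\Omega$: in a state $\sigma$ lying in flaw $f_i$, addressing $f_i$ means moving to a new state $\tau$ drawn from $\rho_i(\sigma,\cdot)$. *)

(* Defs.v *)
From mathcomp Require Import all_boot all_order all_algebra.

Set Implicit Arguments.
Unset Strict Implicit.
Unset Printing Implicit Defensive.

Import Order.TTheory GRing.Theory Num.Theory.
Local Open Scope ring_scope.

Section Defs.
Variables (R : realFieldType) (Omega : finType).

Definition is_distr (p : Omega -> R) : Prop :=
  (forall x, 0 <= p x) /\ \sum_x p x = 1.

Definition prob (mu : Omega -> R) (A : {set Omega}) : R := \sum_(x in A) mu x.

Definition cond_prob (mu : Omega -> R) (A B : {set Omega}) : R :=
  prob mu (A :&: B) / prob mu B.

Variable m : nat.
Implicit Types (mu : Omega -> R) (f : 'I_m -> {set Omega}).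

(* rho i sigma is meaningful only for sigma \in f i; its values at other sigma
   are never used. *)
Implicit Type rho : 'I_m -> Omega -> Omega -> R.

Definition causes f rho (i j : 'I_m) : Prop :=
  exists sigma tau : Omega,
    [/\ sigma \in f i, 0 < rho i sigma tau, tau \in f j
      & i = j \/ sigma \notin f j].

Definition out_neighbors (C : rel 'I_m) (i : 'I_m) : {set 'I_m} :=
  [set j | C i j].

Definition charge_at mu f rho (i : 'I_m) (tau : Omega) : R :=
  \sum_(sigma in f i) mu sigma / mu tau * rho i sigma tau.

(* The default value 0 of the iterated maximum is harmless: every charge_at is
   nonnegative and Omega is nonempty, so this is the maximum over Omega; see
   charge_at_le and charge_attained. *)
Definition charge mu f rho (i : 'I_m) : R :=
  \big[Num.max/0]_(tau : Omega) charge_at mu f rho i tau.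

Lemma charge_at_le mu f rho i tau :
  charge_at mu f rho i tau <= charge mu f rho i.
Proof. exact: le_bigmax. Qed.

Lemma charge_attained mu f rho i :
    is_distr mu -> (forall sigma, sigma \in f i -> is_distr (rho i sigma)) ->
  exists tau, charge mu f rho i = charge_at mu f rho i tau.
Proof.
move=> [mu0 mu1] rhoP.
have [tau0 _|O0] := pickP (@predT Omega); last first.
  by move/eqP: mu1; rewrite big_pred0 // eq_sym oner_eq0.
have ge0 tau : 0 <= charge_at mu f rho i tau.
  apply: sumr_ge0 => sigma /rhoP [rho0 _].
  by rewrite mulr_ge0 // divr_ge0.
rewrite /charge (@bigmax_eq_arg _ _ _ 0 tau0 predT) //.
by exists [arg max_(tau > tau0) charge_at mu f rho i tau]%O.
Qed.

End Defs.

(* Main.v *)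
(* Write B for the event that no flaw of S occurs. Addressing f_i from a state
   of B never leaves B, since a flaw of S appearing there would be caused by
   f_i. Hence mu(f_i :&: B) is at most the mass flowing from f_i into B, and by
   definition of the charge the mass flowing into each tau is at most
   gamma_i mu(tau). *)
Require Import Defs.
From mathcomp Require Import all_boot all_order all_algebra.
Import Order.TTheory GRing.Theory Num.Theory.
Local Open Scope ring_scope.

Lemma in_avoid (Omega : finType) (m : nat) (f : 'I_m -> {set Omega})
    (S : {set 'I_m}) (x : Omega) :
  reflect (forall j, j \in S -> x \notin f j) (x \in \bigcap_(j in S) ~: f j).
Proof.
by apply: (iffP bigcapP) => xS j /xS; rewrite inE.
Qed.

Lemma uncaused_flaws_avoided (R : realFieldType) (Omega : finType) (m : nat)
    (f : 'I_m -> {set Omega}) (rho : 'I_m -> Omega -> Omega -> R) (i : 'I_m)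
    (S : {set 'I_m}) (sigma tau : Omega) :
    (forall j, j \in S -> ~ causes f rho i j) ->
    sigma \in f i -> 0 < rho i sigma tau ->
    sigma \in \bigcap_(j in S) ~: f j ->
  tau \in \bigcap_(j in S) ~: f j.
Proof.
move=> ncause sf rho_gt0 /in_avoid sS; apply/in_avoid => j jS.
apply/negP => tf; apply: (ncause j jS).
(* Since [sigma] avoids [f j] while [tau] lies in it, the second alternative of [causes] holds. *)
by exists sigma, tau; split=> //; right; apply: sS.
Qed.

(** Dividing by [mu tau] turns the inflow into [charge_at] at [tau], one of the values whose maximum
    is the charge. *)
Lemma inflow_le_charge (R : realFieldType) (Omega : finType) (mu : Omega -> R)
    (m : nat) (f : 'I_m -> {set Omega}) (rho : 'I_m -> Omega -> Omega -> R)
    (i : 'I_m) (tau : Omega) :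
    0 < mu tau ->
  \sum_(sigma in f i) mu sigma * rho i sigma tau <= charge mu f rho i * mu tau.
Proof.
move=> mu_gt0; rewrite -ler_pdivrMr // mulr_suml.
apply: le_trans (charge_at_le mu f rho i tau).
by apply: ler_sum => sigma _; rewrite mulrAC.
Qed.

Theorem theorem11 (R : realFieldType) (Omega : finType) (mu : Omega -> R)
    (mu_distr : is_distr mu) (mu_gt0 : forall sigma : Omega, 0 < mu sigma)
    (m : nat) (f : 'I_m -> {set Omega})
    (rho : 'I_m -> Omega -> Omega -> R)
    (rho_distr : forall (i : 'I_m) (sigma : Omega),
        sigma \in f i -> is_distr (rho i sigma))
    (C : rel 'I_m)
    (C_causes : forall i j : 'I_m, causes f rho i j -> C i j)
    (i : 'I_m) (S : {set 'I_m})
    (S_sub : S \subset ~: out_neighbors C i)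
    (S_gt0 : 0 < prob mu (\bigcap_(j in S) ~: f j)) :
  cond_prob mu (f i) (\bigcap_(j in S) ~: f j) <= charge mu f rho i.
Proof.
set B := \bigcap_(j in S) ~: f j in S_gt0 *.
have ncause j : j \in S -> ~ causes f rho i j.
  by move=> jS /C_causes Cij; have := subsetP S_sub j jS; rewrite !inE Cij.
have rho_ge0 sigma tau : sigma \in f i -> 0 <= rho i sigma tau.
  by move=> /rho_distr [].
have rhoB sigma : sigma \in f i :&: B -> \sum_(tau in B) rho i sigma tau = 1.
  rewrite inE => /andP[sf sB]; have [_ <-] := rho_distr i sigma sf.
  (* Terms with [tau] outside [B] vanish: they are nonnegative, and a positive one would force [tau]
     into [B]. *)
  rewrite [RHS](bigID (mem B)) /= [X in _ + X]big1 ?addr0 // => tau tB.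
  apply/eqP; rewrite eq_le rho_ge0 // andbT leNgt; apply: contraNN tB => rho_gt0.
  exact: uncaused_flaws_avoided ncause sf rho_gt0 sB.
rewrite /cond_prob ler_pdivrMr //.
(* Split the mass of each [sigma] by its destination; by [rhoB] destinations in [B] account for all
   of it. *)
have -> : prob mu (f i :&: B) =
    \sum_(tau in B) \sum_(sigma in f i :&: B) mu sigma * rho i sigma tau.
  rewrite exchange_big /=; apply: eq_bigr => sigma sfB.
  by rewrite -mulr_sumr rhoB // mulr1.
(* [prob mu B] is also a sum over [tau] in [B], so the bound can be checked at each destination. *)
rewrite mulr_sumr; apply: ler_sum => tau _.
apply: le_trans (inflow_le_charge _ _ _ _ f rho i tau (mu_gt0 tau)).
(* Sources in [f i] outside [B] only add nonnegative inflow. *)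
rewrite [leRHS](big_setID B) /= lerDl.
apply: sumr_ge0 => sigma; rewrite inE => /andP[_ sf].
by rewrite mulr_ge0 ?rho_ge0 // ltW.
Qed.
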